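(* Let $M = \begin{pmatrix} M' & W_\varepsilon \end{pmatrix} \in \mathbb{Q}_+^{6\times 11}$ be the block matrix whose first six columns are \[ M' = \begin{pmatrix} \frac{5}{44} & \frac{5}{11} & \frac{85}{121} & 0 & 0 & 0\\ 0 & 0 & 0 & \frac{2}{11} & \frac{3}{11} & \frac{7}{33}\\ \frac{1}{11} & \frac{1}{44} & \frac{2}{121} & \frac{1}{44} & \frac{15}{88} & \frac{17}{88}\\ \frac{1}{44} & \frac{1}{44} & \frac{8}{121} & \frac{1}{44} & \frac{19}{88} & \frac{5}{24}\\ \frac{3}{11} & \frac{3}{11} & \frac{12}{121} & \frac{8}{11} & \frac{2}{11} & \frac{2}{33}\\ \frac{1}{2} & \frac{5}{22} & \frac{14}{121} & \frac{1}{22} & \frac{7}{44} & \frac{43}{132} \end{pmatrix} \] and whose last five columns are \[ W_\varepsilon = \begin{pmatrix} 0 & \frac{133}{165} & \frac{640}{2233} & 0 & 0\\ \frac{1}{111540} & 0 & 0 & \frac{17209}{58047} & \frac{997}{5082}\\ \frac{114721}{892320} & \frac{1}{146850} & \frac{17}{506} & \frac{385}{1759} & \frac{2921}{203280}\\ \frac{47}{1248} & \frac{413}{5874} & \frac{1}{102718} & \frac{2915}{10554} & \frac{4381}{203280}\\ \frac{36}{169} & \frac{22}{267} & \frac{18674}{51359} & \frac{1}{116094} & \frac{3252}{4235}\\ \frac{276953}{446160} & \frac{1009}{24475} & \frac{16239}{51359} & \frac{1100}{5277} & \frac{1}{101640} \end{pmatrix}. \] Then the nonnegative rank of $M$ over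 $\mathbb{R}$ is $5$, and the nonnegative rank of $M$ over $\mathbb{Q}$ is $6$.
   Context: For an ordered field $\mathbb{F}$ (here $\mathbb{R}$ or $\mathbb{Q}$) and a matrix $M \in \mathbb{F}_+^{n\times m}$ with nonnegative entries, a nonnegative matrix factorization (NMF) over $\mathbb{F}$ of inner dimension $d$ is a factorization $M = W\cdot H$ with $W \in \mathbb{F}_+^{n\times d}$ and $H\in\mathbb{F}_+^{d\times m}$ (all entries nonnegative and in $\mathbb{F}$). The nonnegative rank of $M$ over $\mathbb{F}$ is the smallest $d$ for which such a factorization exists. *)

(* Defs.v *)
From mathcomp Require Import all_boot all_order all_algebra.
From mathcomp Require Import reals lra.
Set Implicit Arguments.
Unset Strict Implicit.
Unset Printing Implicit Defensive.
Import Order.TTheory GRing.Theory Num.Theory.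
Local Open Scope ring_scope.

Definition nonneg_mx (F : realFieldType) (n m : nat) (A : 'M[F]_(n, m)) : Prop :=
  forall i j, 0 <= A i j.

Definition has_nmf (F : realFieldType) (n m : nat) (A : 'M[F]_(n, m)) (d : nat)
    : Prop :=
  exists (W : 'M[F]_(n, d)) (H : 'M[F]_(d, m)),
    [/\ nonneg_mx W, nonneg_mx H & A = W *m H].

Definition is_nonneg_rank (F : realFieldType) (n m : nat) (A : 'M[F]_(n, m))
    (d : nat) : Prop :=
  has_nmf A d /\ forall e : nat, has_nmf A e -> (d <= e)%N.

Definition mx_of_rows (F : realFieldType) (n m : nat) (rows : seq (seq F))
    : 'M[F]_(n, m) :=
  \matrix_(i < n, j < m) nth 0 (nth [::] rows i) j.

Definition Mprime : 'M[rat]_(6, 6) :=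
  mx_of_rows 6 6
    [:: [:: 5 / 44; 5 / 11; 85 / 121; 0     ; 0      ; 0];
        [:: 0     ; 0     ; 0       ; 2 / 11; 3 / 11 ; 7 / 33];
        [:: 1 / 11; 1 / 44; 2 / 121 ; 1 / 44; 15 / 88; 17 / 88];
        [:: 1 / 44; 1 / 44; 8 / 121 ; 1 / 44; 19 / 88; 5 / 24];
        [:: 3 / 11; 3 / 11; 12 / 121; 8 / 11; 2 / 11 ; 2 / 33];
        [:: 1 / 2 ; 5 / 22; 14 / 121; 1 / 22; 7 / 44 ; 43 / 132]].

(* Entries are written [k%:R] because a bare [ring_scope] numeral is expanded
   to unary at parsing time, which overflows the stack on the large ones. *)
Definition Weps : 'M[rat]_(6, 5) :=
  mx_of_rows 6 5
    [:: [:: 0                    ; 133%:R / 165%:R   ; 640%:R / 2233%:R   ; 0                  ; 0];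
        [:: 1%:R / 111540%:R     ; 0                 ; 0                  ; 17209%:R / 58047%:R; 997%:R / 5082%:R];
        [:: 114721%:R / 892320%:R; 1%:R / 146850%:R  ; 17%:R / 506%:R     ; 385%:R / 1759%:R   ; 2921%:R / 203280%:R];
        [:: 47%:R / 1248%:R      ; 413%:R / 5874%:R  ; 1%:R / 102718%:R   ; 2915%:R / 10554%:R ; 4381%:R / 203280%:R];
        [:: 36%:R / 169%:R       ; 22%:R / 267%:R    ; 18674%:R / 51359%:R; 1%:R / 116094%:R   ; 3252%:R / 4235%:R];
        [:: 276953%:R / 446160%:R; 1009%:R / 24475%:R; 16239%:R / 51359%:R; 1100%:R / 5277%:R  ; 1%:R / 101640%:R]].

Definition Mmat : 'M[rat]_(6, 6 + 5) := row_mx Mprime Weps.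

Lemma Mmat_nonneg : nonneg_mx Mmat.
Proof.
have hP : nonneg_mx Mprime.
  move=> i j; rewrite mxE.
  case: i => [[|[|[|[|[|[|//]]]]]] hi]; case: j => [[|[|[|[|[|[|//]]]]]] hj];
    cbn [nat_of_ord nth]; lra.
have hW : nonneg_mx Weps.
  move=> i j; rewrite mxE.
  case: i => [[|[|[|[|[|[|//]]]]]] hi]; case: j => [[|[|[|[|[|//]]]]] hj];
    cbn [nat_of_ord nth]; lra.
by move=> i j; rewrite mxE; case: splitP => k _; [exact: hP | exact: hW].
Qed.

(* Main.v *)
Require Import Defs.
From mathcomp Require Import all_boot all_order all_algebra.
From mathcomp Require Import reals lra ring zify.
Set Implicit Arguments.
Unset Strict Implicit.
Unset Printing Implicit Defensive.
Import Order.TTheory GRing.Theory Num.Theory.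
Local Open Scope ring_scope.

(** Number rows from 0 to 5 and columns from 0 to 10.  Every column of M
    vanishes in row 0 (columns 3, 4, 5, 6, 9, 10) or in row 1 (columns 0, 1, 2,
    7, 8), both groups have rank 3, and M has rank 4.  Let M = W H be an NMF with
    at most 5 columns in W.  A column of W used in a group vanishes in the
    corresponding row, so each group needs at least three such columns.  If only
    one column b of W vanishes in row 1 but not in row 0, then the tiny entries of
    columns 7 and 8 push b out of the column space of M, so that at least three
    columns of W vanish in both rows; the same holds for row 0, with columns 9 and
    10.  Both situations at once are excluded by a functional vanishing on W, which
    lies in the two-dimensional left kernel of M.  What remains is that W has two
    columns of each kind and one column c vanishing in both rows, so 5 columns,
    and by the rank count all of them lie in the column space of M.  Then c is
    proportional to (0, 0, 1, t, 4 - 8t, 6 - 4t), and in each of the two facets a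
    triangle with vertex c inside the facet covers three given points: one facet
    forces 2t^2 - 4t + 1 >= 0, the other one <= 0.  Hence t = 1 - sqrt 2 / 2 is
    irrational, and this value of t does give an NMF over the reals. *)

(** * Rank bound for the columns used by a factorization *)

(** Only the columns of [W] in [S] contribute, so [A] factors through them and its rank is at most
    [#|S|]. In case of equality they span the column space of [A], so a left annihilator of [A]
    kills them too. *)
Lemma rank_factor_support (F : fieldType) m d n (A : 'M[F]_(m, n))
    (W : 'M[F]_(m, d)) (H : 'M[F]_(d, n)) (S : {set 'I_d}) :
  \rank A = n -> A = W *m H ->
  (forall i j k, k \notin S -> W i k * H k j = 0) ->
  (n <= #|S|)%N /\
  (#|S| = n -> forall p (L : 'M[F]_(p, m)), L *m A = 0 ->
    forall i k, k \in S -> (L *m W) i k = 0).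
Proof.
move=> rA AE supp.
pose W' := colsub (fun i : 'I_#|S| => enum_val i) W.
pose H' := rowsub (fun i : 'I_#|S| => enum_val i) H.
have AE' : A = W' *m H'.
  apply/matrixP => i j; rewrite AE !mxE (bigID (mem S)) /= addrC big1 ?add0r; last first.
    by move=> k kS; apply: supp.
  rewrite big_enum_val /=; apply: eq_bigr => k _; by rewrite !mxE.
have le : (\rank A <= \rank W')%N by rewrite AE' mxrankM_maxl.
split; first by rewrite -rA (leq_trans le) // rank_leq_col.
move=> cS p L LA i k kS.
have subA : (A^T <= W'^T)%MS by rewrite AE' trmx_mul submxMl.
have subW : (W'^T <= A^T)%MS.
  rewrite -(geq_leqif (mxrank_leqif_sup subA)) !mxrank_tr rA -cS; exact: rank_leq_col.
have [X XE] := submxP subW.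
have LW' : L *m W' = 0.
  by rewrite -[W']trmxK XE trmx_mul trmxK mulmxA LA mul0mx.
have -> : (L *m W) i k = (L *m W') i (enum_rank_in kS k).
  by rewrite !mxE; apply: eq_bigr => l _; rewrite !mxE enum_rankK_in.
by rewrite LW' mxE.
Qed.

(** * Entries of M over an ordered field *)

Definition M_rows (F : realFieldType) : seq (seq F) :=
  [:: [:: 5 / 44; 5 / 11; 85 / 121; 0     ; 0      ; 0;
          0; 133%:R / 165%:R; 640%:R / 2233%:R; 0; 0];
      [:: 0     ; 0     ; 0       ; 2 / 11; 3 / 11 ; 7 / 33;
          1%:R / 111540%:R; 0; 0; 17209%:R / 58047%:R; 997%:R / 5082%:R];
      [:: 1 / 11; 1 / 44; 2 / 121 ; 1 / 44; 15 / 88; 17 / 88;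
          114721%:R / 892320%:R; 1%:R / 146850%:R; 17%:R / 506%:R;
          385%:R / 1759%:R; 2921%:R / 203280%:R];
      [:: 1 / 44; 1 / 44; 8 / 121 ; 1 / 44; 19 / 88; 5 / 24;
          47%:R / 1248%:R; 413%:R / 5874%:R; 1%:R / 102718%:R;
          2915%:R / 10554%:R; 4381%:R / 203280%:R];
      [:: 3 / 11; 3 / 11; 12 / 121; 8 / 11; 2 / 11 ; 2 / 33;
          36%:R / 169%:R; 22%:R / 267%:R; 18674%:R / 51359%:R;
          1%:R / 116094%:R; 3252%:R / 4235%:R];
      [:: 1 / 2 ; 5 / 22; 14 / 121; 1 / 22; 7 / 44 ; 43 / 132;
          276953%:R / 446160%:R; 1009%:R / 24475%:R; 16239%:R / 51359%:R;
          1100%:R / 5277%:R; 1%:R / 101640%:R]].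

Lemma Mmat_rows i j : Mmat i j = nth 0 (nth [::] (M_rows rat) i) j.
Proof.
rewrite mxE; case: splitP => k ->; rewrite mxE.
  case: i => [[|[|[|[|[|[|//]]]]]] hi]; case: k => [[|[|[|[|[|[|//]]]]]] hk];
    cbn [nat_of_ord nth M_rows]; reflexivity.
rewrite -nth_drop.
case: i => [[|[|[|[|[|[|//]]]]]] hi]; case: k => [[|[|[|[|[|//]]]]] hk];
    cbn [nat_of_ord nth M_rows drop]; reflexivity.
Qed.

Lemma map_Mmat_rows (F : realFieldType) i j :
  map_mx (ratr : rat -> F) Mmat i j = nth 0 (nth [::] (M_rows F) i) j.
Proof.
have ratr_frac m n : ratr (m%:R / n%:R) = m%:R / n%:R :> F.
  by rewrite fmorph_div !rmorph_nat.
have ratr_1frac n : ratr (1 / n%:R) = 1 / n%:R :> F.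
  by rewrite fmorph_div rmorph1 rmorph_nat.
rewrite mxE Mmat_rows.
case: i => [[|[|[|[|[|[|//]]]]]] hi];
  case: j => [[|[|[|[|[|[|[|[|[|[|[|//]]]]]]]]]]] hj];
  cbn [nat_of_ord nth M_rows];
  lazymatch goal with
  | |- ratr 0 = _ => exact: rmorph0
  | |- ratr (1 / _) = _ => exact: ratr_1frac
  | |- _ => exact: ratr_frac
  end.
Qed.

(** * Plane geometry of the two facets *)

(** Two negative values would force [h1 = h2 = 0]. In the application, f vanishes at a covered point
    and on c, so one of the other two vertices lies in the half-plane [0 <= f]. *)
Lemma exists_ge0_of_combination (F : realFieldType) (h1 h2 f1 f2 x1 x2 : F) :
  0 <= h1 -> 0 <= h2 -> 0 < h1 * x1 + h2 * x2 -> h1 * f1 + h2 * f2 = 0 ->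
  0 <= f1 \/ 0 <= f2.
Proof.
move=> h1_ge0 h2_ge0 x_gt0 f0.
have [|f1_lt0] := leP 0 f1; first by left.
have [|f2_lt0] := leP 0 f2; first by right.
suff [h10 h20] : h1 = 0 /\ h2 = 0 by move: x_gt0; rewrite h10 h20 !mul0r addr0 ltxx.
have n1 : h1 * f1 <= 0 by rewrite mulr_ge0_le0 // ltW.
have n2 : h2 * f2 <= 0 by rewrite mulr_ge0_le0 // ltW.
have /eqP : h1 * f1 = 0 by lra.
have /eqP : h2 * f2 = 0 by lra.
by rewrite !mulf_eq0 (lt_eqF f1_lt0) (lt_eqF f2_lt0) !orbF => /eqP -> /eqP ->.
Qed.

Section Facets.
Variables (F : realFieldType) (t g : F).

(* In a facet of the nonnegative part of the column space, points are given by
   three homogeneous coordinates (row 0 or row 1, row 2, row 3): (X, P, Q) lies in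
   the cone spanned by (x1, p1, q1), (x2, p2, q2) and c = g (0, 1, t). *)
Definition covers (x1 p1 q1 x2 p2 q2 X P Q : F) := exists h : F * F * F,
  [/\ [/\ 0 <= h.1.1, 0 <= h.1.2 & 0 <= h.2],
      X = h.1.1 * x1 + h.1.2 * x2,
      P = h.1.1 * p1 + h.1.2 * p2 + h.2 * g
    & Q = h.1.1 * q1 + h.1.2 * q2 + h.2 * (g * t)].

Lemma coversC x1 p1 q1 x2 p2 q2 X P Q :
  covers x1 p1 q1 x2 p2 q2 X P Q -> covers x2 p2 q2 x1 p1 q1 X P Q.
Proof.
by case=> -[[h1 h2] hc] [[? ? ?] /= -> -> ->]; exists (h2, h1, hc); split => //=; ring.
Qed.

(* In the affine chart x = 1, the vertex c is at infinity in the direction (1, t):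
   [upperB] and [lowerB] are the closed half-planes above the line of slope t
   through column 2 and below the one through column 0. *)
Let upperB x p q := 0 <= 85 * (q - t * p) - (8 - 2 * t) * x.
Let lowerB x p q := 0 <= (1 - 4 * t) * x - 5 * (q - t * p).

(** A functional [f] that is nonnegative at both vertices and at c is nonnegative at column 1, where
    its value is 75/44 times the quadratic. *)
Lemma facetB_roles x1 p1 q1 x2 p2 q2 :
  0 <= t -> t <= 1 / 2 -> 0 <= g ->
  0 <= p1 -> 0 <= q2 -> 1 / 4 <= t ->
  upperB x1 p1 q1 -> lowerB x2 p2 q2 ->
  covers x1 p1 q1 x2 p2 q2 (5 / 11) (1 / 44) (1 / 44) ->
  0 <= 2 * t ^+ 2 - 4 * t + 1.
Proof.
move=> t_ge0 t_le g_ge0 p1_ge0 q2_ge0 t_ge up lo.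
move=> [[[h1 h2] hc] [[/= h1_ge0 h2_ge0 hc_ge0] EX EP EQ]].
(* f vanishes on the line joining the best possible vertices: the intersection of
   the boundary of [upperB] with p = 0 and that of [lowerB] with q = 0. *)
pose f x p q := 5 * t * (8 - 2 * t) * p + 85 * (4 * t - 1) * q
  - (8 - 2 * t) * (4 * t - 1) * x.
have f1 : 0 <= f x1 p1 q1.
  have -> : f x1 p1 q1 = (4 * t - 1) * (85 * (q1 - t * p1) - (8 - 2 * t) * x1)
     + t * (330 * t - 45) * p1 by rewrite /f; ring.
  rewrite addr_ge0 // !mulr_ge0 //; lra.
have f2 : 0 <= f x2 p2 q2.
  have -> : f x2 p2 q2 = (8 - 2 * t) * ((1 - 4 * t) * x2 - 5 * (q2 - t * p2))
     + (330 * t - 45) * q2 by rewrite /f; ring.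
  rewrite addr_ge0 // !mulr_ge0 //; lra.
have fc : 0 <= f 0 g (g * t).
  have -> : f 0 g (g * t) = t * (330 * t - 45) * g by rewrite /f; ring.
  rewrite !mulr_ge0 //; lra.
have E : 75 * (2 * t ^+ 2 - 4 * t + 1) =
    44 * (h1 * f x1 p1 q1 + h2 * f x2 p2 q2 + hc * f 0 g (g * t)).
  have -> : h1 * f x1 p1 q1 + h2 * f x2 p2 q2 + hc * f 0 g (g * t) =
    f (h1 * x1 + h2 * x2) (h1 * p1 + h2 * p2 + hc * g) (h1 * q1 + h2 * q2 + hc * (g * t)).
    by rewrite /f; ring.
  by rewrite -EX -EP -EQ /f; field.
have : 0 <= h1 * f x1 p1 q1 + h2 * f x2 p2 q2 + hc * f 0 g (g * t).
  by rewrite !addr_ge0 // mulr_ge0.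
lra.
Qed.

Lemma facetB x1 p1 q1 x2 p2 q2 :
  0 <= t -> t <= 1 / 2 -> 0 <= g ->
  0 < x1 -> 0 < x2 -> 0 <= p1 -> 0 <= p2 -> 0 <= q1 -> 0 <= q2 ->
  covers x1 p1 q1 x2 p2 q2 (5 / 44) (1 / 11) (1 / 44) ->
  covers x1 p1 q1 x2 p2 q2 (5 / 11) (1 / 44) (1 / 44) ->
  covers x1 p1 q1 x2 p2 q2 (85 / 121) (2 / 121) (8 / 121) ->
  0 <= 2 * t ^+ 2 - 4 * t + 1.
Proof.
move=> t_ge0 t_le g_ge0 x1_gt0 x2_gt0 p1_ge0 p2_ge0 q1_ge0 q2_ge0 C0 C1 C2.
(* Below 1/4 the quadratic is positive, its smaller root being [1 - sqrt 2 / 2]. *)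
have [t_lt|t_ge] := ltP t (1 / 4); first by nra.
(* For [t > 3/22] the line through column 2 runs strictly above the one through column 0, so each
   vertex takes at most one role. *)
have not_both x p q : 0 < x -> upperB x p q -> lowerB x p q -> False.
  by rewrite /upperB /lowerB; nra.
(* Column 2 lies on the boundary of [upperB], and c contributes nothing since [q - t * p] vanishes
   on it. *)
have up : upperB x1 p1 q1 \/ upperB x2 p2 q2.
  case: C2 => -[[h1 h2] hc] [[/= h1_ge0 h2_ge0 hc_ge0] EX EP EQ].
  apply: (@exists_ge0_of_combination F h1 h2 _ _ x1 x2) => //; first by rewrite -EX; lra.
  transitivity (85 * (8 / 121 - t * (2 / 121)) - (8 - 2 * t) * (85 / 121)); last by field.
  by rewrite EX EP EQ; ring.
have lo : lowerB x1 p1 q1 \/ lowerB x2 p2 q2.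
  case: C0 => -[[h1 h2] hc] [[/= h1_ge0 h2_ge0 hc_ge0] EX EP EQ].
  apply: (@exists_ge0_of_combination F h1 h2 _ _ x1 x2) => //; first by rewrite -EX; lra.
  transitivity ((1 - 4 * t) * (5 / 44) - 5 * (1 / 44 - t * (1 / 11))); last by field.
  by rewrite EX EP EQ; ring.
case: up => up; case: lo => lo.
- by case: (not_both _ _ _ x1_gt0 up lo).
- exact: facetB_roles C1.
- exact: facetB_roles (coversC C1).
- by case: (not_both _ _ _ x2_gt0 up lo).
Qed.

(* The lines of slope t through columns 5 and 3. *)
Let upperA x p q := 0 <= 56 * (q - t * p) - (55 - 51 * t) * x.
Let lowerA x p q := 0 <= (1 - t) * x - 8 * (q - t * p).

(** In this facet [9 * x + 8 * p - 16 * q] is twice row 4 and [3 * p - 2 * q] is half of row 5. The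
    value of [f] at column 4 is a negative multiple of the quadratic. *)
Lemma facetA_roles x1 p1 q1 x2 p2 q2 :
  0 <= t -> t <= 1 / 2 -> 0 <= g ->
  0 <= 9 * x1 + 8 * p1 - 16 * q1 -> 0 <= 3 * p2 - 2 * q2 ->
  upperA x1 p1 q1 -> lowerA x2 p2 q2 ->
  covers x1 p1 q1 x2 p2 q2 (3 / 11) (15 / 88) (19 / 88) ->
  2 * t ^+ 2 - 4 * t + 1 <= 0.
Proof.
move=> t_ge0 t_le g_ge0 s1 s2 up lo.
move=> [[[h1 h2] hc] [[/= h1_ge0 h2_ge0 hc_ge0] EX EP EQ]].
have [//|pt] := leP (2 * t ^+ 2 - 4 * t + 1) 0.
(* This rough bound gives the sign of the coefficient [31 - 78 * t] in the decomposition of [f] at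
   the second vertex. *)
have t_lt : t <= 31 / 78 by nra.
(* f vanishes on the line joining the best possible vertices: the intersection of
   the boundary of [upperA] with row 4 = 0 and that of [lowerA] with row 5 = 0. *)
pose f x p q := (1 - t) * (31 - 78 * t) * x + 8 * (144 - 389 * t + 186 * t ^+ 2) * p
  - 8 * (127 - 358 * t + 176 * t ^+ 2) * q.
have f1 : 0 <= f x1 p1 q1.
  have -> : f x1 p1 q1 = 4 * ((12 - 11 * t) * (3 - 2 * t)) * (9 * x1 + 8 * p1 - 16 * q1)
     + (23 - 14 * t) * (56 * (q1 - t * p1) - (55 - 51 * t) * x1) by rewrite /f; ring.
  rewrite addr_ge0 // !mulr_ge0 //; lra.
have f2 : 0 <= f x2 p2 q2.
  have -> : f x2 p2 q2 = 32 * ((1 - 2 * t) * (12 - 11 * t)) * (3 * p2 - 2 * q2)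
     + (31 - 78 * t) * ((1 - t) * x2 - 8 * (q2 - t * p2)) by rewrite /f; ring.
  rewrite addr_ge0 // !mulr_ge0 //; lra.
have fc : 0 <= f 0 g (g * t).
  have -> : f 0 g (g * t) = 32 * ((1 - 2 * t) * (12 - 11 * t) * (3 - 2 * t)) * g
    by rewrite /f; ring.
  rewrite !mulr_ge0 //; lra.
have E : - 1280 * (2 * t ^+ 2 - 4 * t + 1) =
    88 * (h1 * f x1 p1 q1 + h2 * f x2 p2 q2 + hc * f 0 g (g * t)).
  have -> : h1 * f x1 p1 q1 + h2 * f x2 p2 q2 + hc * f 0 g (g * t) =
    f (h1 * x1 + h2 * x2) (h1 * p1 + h2 * p2 + hc * g) (h1 * q1 + h2 * q2 + hc * (g * t)).
    by rewrite /f; ring.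
  by rewrite -EX -EP -EQ /f; field.
have : 0 <= h1 * f x1 p1 q1 + h2 * f x2 p2 q2 + hc * f 0 g (g * t).
  by rewrite !addr_ge0 // mulr_ge0.
lra.
Qed.

Lemma facetA x1 p1 q1 x2 p2 q2 :
  0 <= t -> t <= 1 / 2 -> 0 <= g ->
  0 < x1 -> 0 < x2 ->
  0 <= 9 * x1 + 8 * p1 - 16 * q1 -> 0 <= 9 * x2 + 8 * p2 - 16 * q2 ->
  0 <= 3 * p1 - 2 * q1 -> 0 <= 3 * p2 - 2 * q2 ->
  covers x1 p1 q1 x2 p2 q2 (2 / 11) (1 / 44) (1 / 44) ->
  covers x1 p1 q1 x2 p2 q2 (3 / 11) (15 / 88) (19 / 88) ->
  covers x1 p1 q1 x2 p2 q2 (7 / 33) (17 / 88) (5 / 24) ->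
  2 * t ^+ 2 - 4 * t + 1 <= 0.
Proof.
move=> t_ge0 t_le g_ge0 x1_gt0 x2_gt0 r1 r2 s1 s2 C0 C1 C2.
have not_both x p q : 0 < x -> upperA x p q -> lowerA x p q -> False.
  by rewrite /upperA /lowerA; nra.
have up : upperA x1 p1 q1 \/ upperA x2 p2 q2.
  case: C2 => -[[h1 h2] hc] [[/= h1_ge0 h2_ge0 hc_ge0] EX EP EQ].
  apply: (@exists_ge0_of_combination F h1 h2 _ _ x1 x2) => //; first by rewrite -EX; lra.
  transitivity (56 * (5 / 24 - t * (17 / 88)) - (55 - 51 * t) * (7 / 33) : F);
    last by field.
  by rewrite EX EP EQ; ring.
have lo : lowerA x1 p1 q1 \/ lowerA x2 p2 q2.
  case: C0 => -[[h1 h2] hc] [[/= h1_ge0 h2_ge0 hc_ge0] EX EP EQ].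
  apply: (@exists_ge0_of_combination F h1 h2 _ _ x1 x2) => //; first by rewrite -EX; lra.
  transitivity ((1 - t) * (h1 * x1 + h2 * x2) - 8 * (h1 * q1 + h2 * q2 + hc * (g * t)
    - t * (h1 * p1 + h2 * p2 + hc * g))); first by ring.
  by rewrite -EX -EP -EQ; field.
case: up => up; case: lo => lo.
- by case: (not_both _ _ _ x1_gt0 up lo).
- exact: facetA_roles C1.
- exact: facetA_roles (coversC C1).
- by case: (not_both _ _ _ x2_gt0 up lo).
Qed.

End Facets.

(** * The explicit factorization over the reals *)

(** Column 0 is c for [t = 1 - s / 2]. Columns 1, 2 and 3, 4 are the best possible vertices from
    [facetB_roles] and [facetA_roles], scaled to 1 in row 0 or row 1. *)
Definition sqrt2_W_rows (R : realFieldType) (s : R) : seq (seq R) :=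
    [:: [:: 0; 1; 1; 0; 0];
        [:: 0; 0; 0; 1; 1];
        [:: 1; 0; 2%:R / 5%:R - (1 / 5%:R) * s;
            47%:R / 56%:R - (1 / 14%:R) * s; 1 / 4%:R - (1 / 8%:R) * s];
        [:: 1 - (1 / 2%:R) * s; 6%:R / 85%:R + (1 / 85%:R) * s; 0;
            55%:R / 56%:R - (1 / 28%:R) * s;
            3%:R / 8%:R - (3%:R / 16%:R) * s];
        [:: 4%:R * s - 4%:R; 4%:R / 17%:R - (8%:R / 85%:R) * s;
            12%:R / 5%:R - (4%:R / 5%:R) * s; 0; 5%:R / 2%:R + s];
        [:: 2%:R + 2%:R * s; 2%:R / 17%:R - (4%:R / 85%:R) * s;
            14%:R / 5%:R - (6%:R / 5%:R) * s;
            31%:R / 28%:R - (2%:R / 7%:R) * s; 0]].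

Definition sqrt2_H_rows (R : realFieldType) (s : R) : seq (seq R) :=
    [:: [:: 1 / 22%:R + (1 / 44%:R) * s; 0; 2%:R / 121%:R;
            (1 / 44%:R) * s - 1 / 44%:R; 0; 1 / 66%:R + (1 / 66%:R) * s;
            28679%:R / 892320%:R + (30419%:R / 446160%:R) * s;
            11582%:R / 1541925%:R - (248%:R / 46725%:R) * s;
            (2741%:R / 1078539%:R) * s - 1284%:R / 359513%:R;
            15595%:R / 1857504%:R - (689%:R / 116094%:R) * s;
            (389%:R / 20328%:R) * s - 5501%:R / 203280%:R];
        [:: 0; 15%:R / 44%:R - (5%:R / 88%:R) * s; 85%:R / 121%:R; 0; 0; 0; 0;
            503929%:R / 616770%:R - (9593%:R / 1233540%:R) * s;
            244775%:R / 2157078%:R - (346055%:R / 4314156%:R) * s; 0; 0];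
        [:: 5%:R / 44%:R; 5%:R / 44%:R + (5%:R / 88%:R) * s; 0; 0; 0; 0; 0;
            (9593%:R / 1233540%:R) * s - 1355%:R / 123354%:R;
            373465%:R / 2157078%:R + (346055%:R / 4314156%:R) * s; 0; 0];
        [:: 0; 0; 0; 0; 31%:R / 187%:R + (8%:R / 187%:R) * s; 7%:R / 33%:R;
            178019%:R / 948090%:R - (251749%:R / 1896180%:R) * s; 0; 0;
            79591%:R / 358836%:R + (69463%:R / 1315732%:R) * s;
            (4531%:R / 431970%:R) * s - 3203%:R / 215985%:R];
        [:: 0; 0; 0; 2%:R / 11%:R; 20%:R / 187%:R - (8%:R / 187%:R) * s; 0;
            (251749%:R / 1896180%:R) * s - 356021%:R / 1896180%:R; 0; 0;
            98237%:R / 1315732%:R - (69463%:R / 1315732%:R) * s;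
            91151%:R / 431970%:R - (4531%:R / 431970%:R) * s]].

Definition sqrt2_W (R : realFieldType) (s : R) := mx_of_rows 6 5 (sqrt2_W_rows s).
Definition sqrt2_H (R : realFieldType) (s : R) := mx_of_rows 5 11 (sqrt2_H_rows s).

(** Consecutive convergents of sqrt 2. Some entries of [sqrt2_H] are so close to 0 that a bound like
    7/5 would not settle their sign. *)
Lemma sqrt2_bounds (R : realFieldType) (s : R) :
  0 <= s -> s * s = 2 -> 1393 / 985 <= s <= 577 / 408.
Proof.
move=> s_ge0 ss; rewrite !leNgt; apply/andP; split; apply/negP => lt_s; nra.
Qed.

Lemma sqrt2_W_ge0 (R : realFieldType) (s : R) :
  0 <= s -> s * s = 2 -> nonneg_mx (sqrt2_W s).
Proof.
move=> s_ge0 ss; have /andP[s_ge s_le] := sqrt2_bounds s_ge0 ss.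
clear s_ge0 ss.
move=> i j; rewrite mxE.
case: i => [[|[|[|[|[|[|//]]]]]] hi]; case: j => [[|[|[|[|[|//]]]]] hj];
  cbn [nat_of_ord nth sqrt2_W_rows]; lra.
Qed.

Lemma sqrt2_H_ge0 (R : realFieldType) (s : R) :
  0 <= s -> s * s = 2 -> nonneg_mx (sqrt2_H s).
Proof.
move=> s_ge0 ss; have /andP[s_ge s_le] := sqrt2_bounds s_ge0 ss.
clear s_ge0 ss.
move=> i j; rewrite mxE.
case: i => [[|[|[|[|[|//]]]]] hi];
  case: j => [[|[|[|[|[|[|[|[|[|[|[|//]]]]]]]]]]] hj];
  cbn [nat_of_ord nth sqrt2_H_rows]; lra.
Qed.

Lemma sqrt2_WH (R : realFieldType) (s : R) :
  s * s = 2 -> map_mx (ratr : rat -> R) Mmat = sqrt2_W s *m sqrt2_H s.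
Proof.
move=> ss; apply/matrixP => i j; rewrite map_Mmat_rows mxE.
pose f (k : nat) := nth 0 (nth [::] (sqrt2_W_rows s) i) k
  * nth 0 (nth [::] (sqrt2_H_rows s) k) j.
have -> : \sum_(k < 5) sqrt2_W s i k * sqrt2_H s k j
    = f 0%N + f 1%N + f 2%N + f 3%N + f 4%N.
  rewrite (eq_bigr (fun k : 'I_5 => f k)) => [|k _]; last by rewrite !mxE.
  by rewrite !big_ord_recr big_ord0 /= add0r.
rewrite {}/f.
case: i => [[|[|[|[|[|[|//]]]]]] hi];
  case: j => [[|[|[|[|[|[|[|[|[|[|[|//]]]]]]]]]]] hj];
  cbn [nat_of_ord nth M_rows sqrt2_W_rows sqrt2_H_rows].
(* The only nonlinear monomial is [s * s], an atom whose value [ss] supplies. *)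
all: lra.
Qed.

(** * Column ranks and left kernel of M *)

Lemma sum_inord6 (V : nmodType) (f : 'I_6 -> V) :
  \sum_(i < 6) f i = f (inord 0) + f (inord 1) + f (inord 2) + f (inord 3)
    + f (inord 4) + f (inord 5).
Proof.
rewrite !big_ord_recr big_ord0 /= add0r.
by congr (_ + _ + _ + _ + _ + _); congr f; apply: val_inj; rewrite /= inordK.
Qed.

Lemma sum_inord3 (V : nmodType) (f : 'I_3 -> V) :
  \sum_(i < 3) f i = f (inord 0) + f (inord 1) + f (inord 2).
Proof.
rewrite !big_ord_recr big_ord0 /= add0r.
by congr (_ + _ + _); congr f; apply: val_inj; rewrite /= inordK.
Qed.

Definition Mcol (j : nat) : 'I_(6 + 5) := @inord 10 j.

Section Entries.
Variable F : realFieldType.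

Definition MF : 'M[F]_(6, 6 + 5) := map_mx (ratr : rat -> F) Mmat.

Lemma MF_entry (i j : nat) : (i < 6)%N -> (j < 11)%N ->
  MF (inord i) (Mcol j) = nth 0 (nth [::] (M_rows F) i) j.
Proof. by move=> i6 j11; rewrite /MF map_Mmat_rows !inordK. Qed.

(** The two rows express rows 4 and 5 of M through rows 0 to 3. *)
Definition left_kernel : 'M[F]_(2, 6) := mx_of_rows 2 6
  [:: [:: - 4 / 5; - 9 / 2; - 4; 8; 1; 0]; [:: - 2 / 5; 0; - 6; 4; 0; 1]].

(* [M3cols 0] and [M3cols 3] span the column spaces of the two groups. *)
Definition M3cols (b : nat) : 'M[F]_(6, 3) := \matrix_(i, j) MF i (Mcol (b + j)).

Lemma M3colsE b i j : M3cols b i j = MF i (Mcol (b + j)).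
Proof. by rewrite mxE. Qed.

Lemma left_kernelE n (A : 'M[F]_(6, n)) k :
  (left_kernel *m A) (inord 0) k = - 4 / 5 * A (inord 0) k - 9 / 2 * A (inord 1) k
    - 4 * A (inord 2) k + 8 * A (inord 3) k + A (inord 4) k
  /\ (left_kernel *m A) (inord 1) k = - 2 / 5 * A (inord 0) k
    - 6 * A (inord 2) k + 4 * A (inord 3) k + A (inord 5) k.
Proof. by rewrite !mxE !sum_inord6 !mxE !inordK //=; split; ring. Qed.

Lemma left_kernel_M3cols b : b = 0%N \/ b = 3%N -> left_kernel *m M3cols b = 0.
Proof.
move=> hb; apply/matrixP => i j.
have [E1 E2] := left_kernelE (M3cols b) j.
rewrite [RHS]mxE.
case: i => [[|[|//]] hi].
  rewrite (_ : Ordinal hi = inord 0) ?E1; last by apply: val_inj; rewrite /= inordK.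
  by rewrite !M3colsE; case: hb => ->; case: j {E1 E2} => [[|[|[|//]]] hj];
    cbn [nat_of_ord]; rewrite ?addn0 ?addn1 ?addn2 !MF_entry //;
    cbn [nth M_rows]; lra.
rewrite (_ : Ordinal hi = inord 1) ?E2; last by apply: val_inj; rewrite /= inordK.
by rewrite !M3colsE; case: hb => ->; case: j {E1 E2} => [[|[|[|//]]] hj];
  cbn [nat_of_ord]; rewrite ?addn0 ?addn1 ?addn2 !MF_entry //;
    cbn [nth M_rows]; lra.
Qed.

Lemma rank_M3cols b : b = 0%N \/ b = 3%N -> \rank (M3cols b) = 3.
Proof.
move=> hb; rewrite -mxrank_tr; apply/eqP/inj_row_free => v v0.
have E i : v 0 (inord 0) * MF (inord i) (Mcol b)
   + v 0 (inord 1) * MF (inord i) (Mcol b.+1)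
   + v 0 (inord 2) * MF (inord i) (Mcol b.+2) = 0.
  have := congr1 (fun A : 'M_(_, _) => A 0 (inord i)) v0.
  by rewrite [RHS]mxE mxE sum_inord3 ![_^T _ _]mxE !M3colsE !inordK // addn0 addn1 addn2.
have [e0 e1 e2] : [/\ v 0 (inord 0) = 0, v 0 (inord 1) = 0 & v 0 (inord 2) = 0].
  move: (E 0%N) (E 1%N) (E 2%N) (E 3%N) (E 4%N).
  by case: hb => ->; rewrite !MF_entry //; cbn [nth M_rows] => *; split; lra.
apply/rowP => -[[|[|[|//]]] hj]; rewrite [RHS]mxE.
- by rewrite -[RHS]e0; congr (v _ _); apply: val_inj; rewrite /= inordK.
- by rewrite -[RHS]e1; congr (v _ _); apply: val_inj; rewrite /= inordK.
- by rewrite -[RHS]e2; congr (v _ _); apply: val_inj; rewrite /= inordK.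
Qed.

End Entries.

(** * Types of columns in a nonnegative factorization *)

Section NMF.
Variables (F : realFieldType) (d : nat) (W : 'M[F]_(6, d)) (H : 'M[F]_(d, 6 + 5)).
Hypotheses (W_ge0 : nonneg_mx W) (H_ge0 : nonneg_mx H) (MWH : MF F = W *m H).

Let w (i : nat) k := W (inord i) k.

Definition zero_cols (r : nat) : {set 'I_d} := [set k | w r k == 0].
Definition only_cols (r r' : nat) : {set 'I_d} := zero_cols r' :\: zero_cols r.
Definition edge_cols : {set 'I_d} := zero_cols 0 :&: zero_cols 1.

Lemma MF_sum i j : MF F i j = \sum_k W i k * H k j.
Proof. by rewrite MWH mxE. Qed.

Lemma unused_cols r j : MF F (inord r) j = 0 ->
  forall k, k \notin zero_cols r -> H k j = 0.
Proof.
rewrite MF_sum => /eqP; rewrite psumr_eq0 => [/allP e k|k _]; last by rewrite mulr_ge0.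
rewrite inE => wk; apply/eqP.
by have := e k (mem_index_enum _); rewrite mulf_eq0 (negPf wk).
Qed.

(** Row [r] of column [j] comes from [b] alone, while the other rows receive at least the share of
    [b]. A tiny entry of M thus makes [w i b] tiny relative to [w r b]. *)
Lemma single_col_bound r r' b j : MF F (inord r') j = 0 -> only_cols r r' = [set b] ->
  forall i, w i b * MF F (inord r) j <= MF F (inord i) j * w r b.
Proof.
move=> z ob i.
have -> : MF F (inord r) j = w r b * H b j.
  rewrite MF_sum (bigD1 b) //= big1 ?addr0 // => k kb.
  have [kz|kz] := boolP (k \in zero_cols r'); last by rewrite (unused_cols z kz) mulr0.
  have : k \notin only_cols r r' by rewrite ob inE.
  by rewrite in_setD kz andbT negbK inE /w => /eqP ->; rewrite mul0r.
rewrite mulrCA mulrC ler_wpM2r //; first exact: W_ge0.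
rewrite MF_sum (bigD1 b) //= lerDl sumr_ge0 // => k _.
by rewrite mulr_ge0.
Qed.

(** The rank count for one group; the final equations say that [left_kernel] kills column [k] of
    [W]. *)
Lemma card_zero_cols r b : b = 0%N \/ b = 3%N ->
  (forall j : 'I_3, MF F (inord r) (Mcol (b + j)) = 0) ->
  (forall S : {set 'I_d}, (forall i (j : 'I_3) k, k \notin S -> W i k * H k (Mcol (b + j)) = 0)
     -> (2 < #|S|)%N) /\
  (#|zero_cols r| = 3 -> forall k, k \in zero_cols r ->
     w 4 k = 4 / 5 * w 0 k + 9 / 2 * w 1 k + 4 * w 2 k - 8 * w 3 k
     /\ w 5 k = 2 / 5 * w 0 k + 6 * w 2 k - 4 * w 3 k).
Proof.
move=> hb z.
pose H3 : 'M[F]_(d, 3) := \matrix_(k, j) H k (Mcol (b + j)).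
have E3 : M3cols F b = W *m H3.
  apply/matrixP => i j; rewrite M3colsE MF_sum mxE.
  by apply: eq_bigr => k _; rewrite [H3 _ _]mxE.
split=> [S SE|cz k kz].
  have [] // := rank_factor_support (rank_M3cols F hb) E3 (S := S) _.
  by move=> i j k kS; rewrite mxE SE.
have supp i j l : l \notin zero_cols r -> W i l * H3 l j = 0.
  by move=> lz; rewrite mxE (unused_cols (z j) lz) mulr0.
have [_ /(_ cz 2 (left_kernel F) (left_kernel_M3cols F hb)) lk] :=
  rank_factor_support (rank_M3cols F hb) E3 supp.
have [E1 E2] := left_kernelE W k.
move: (lk (inord 0) k kz) (lk (inord 1) k kz).
by rewrite E1 E2 /w => *; split; lra.
Qed.

Lemma MF_zeroB (j : 'I_3) : MF F (inord 1) (Mcol (0 + j)) = 0.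
Proof. by case: j => [[|[|[|//]]] hj]; rewrite MF_entry. Qed.

Lemma MF_zeroA (j : 'I_3) : MF F (inord 0) (Mcol (3 + j)) = 0.
Proof. by case: j => [[|[|[|//]]] hj]; rewrite MF_entry. Qed.

Lemma two_cols_sum r r' b1 b2 c j : MF F (inord r') j = 0 -> b1 != b2 ->
  only_cols r r' = [set b1; b2] -> zero_cols r :&: zero_cols r' = [set c] ->
  forall i, MF F i j = W i b1 * H b1 j + W i b2 * H b2 j + W i c * H c j.
Proof.
move=> z b12 ob ec i.
have zE : zero_cols r' = c |: [set b1; b2].
  by rewrite -(setID (zero_cols r') (zero_cols r)) -/(only_cols r r') ob setIC ec.
have c_in : c \in zero_cols r :&: zero_cols r' by rewrite ec set11.
have cN : c \notin [set b1; b2].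
  by rewrite -ob in_setD; case/setIP: c_in => ->.
rewrite MF_sum (bigID (mem (zero_cols r'))) /= addrC big1 ?add0r; last first.
  by move=> k kz; rewrite (unused_cols z kz) mulr0.
by rewrite zE big_setU1 //= big_setU1 ?inE //= big_set1 addrC.
Qed.

Lemma only_cols_gt0 r r' j : MF F (inord r') j = 0 -> MF F (inord r) j != 0 ->
  (0 < #|only_cols r r'|)%N.
Proof.
move=> z nz; rewrite card_gt0; apply: contraNneq nz => o0.
rewrite MF_sum big1 // => k _.
have [kz|kz] := boolP (k \in zero_cols r'); last by rewrite (unused_cols z kz) mulr0.
have : k \notin only_cols r r' by rewrite o0 inE.
by rewrite in_setD kz andbT negbK inE /w => /eqP ->; rewrite mul0r.
Qed.

Let l1 k := - 4 / 5 * w 0 k - 9 / 2 * w 1 k - 4 * w 2 k + 8 * w 3 k + w 4 k.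
Let l2 k := - 2 / 5 * w 0 k - 6 * w 2 k + 4 * w 3 k + w 5 k.

(** Column 7 is tiny in row 2 and column 8 in row 3, so [l1 b] and [l2 b] are governed by the
    negative coefficients of [w 0 b]. *)
Lemma single_colB b : only_cols 0 1 = [set b] ->
  [/\ 0 < w 0 b, - 81 / 100 * w 0 b <= l1 b, l1 b < 0 & l2 b <= - 1 / 3 * w 0 b].
Proof.
move=> ob.
have : b \in only_cols 0 1 by rewrite ob set11.
rewrite !inE => /andP[x_neq0 /eqP w1].
have x_gt0 : 0 < w 0 b by rewrite lt_neqAle eq_sym x_neq0 W_ge0.
have z7 : MF F (inord 1) (Mcol 7) = 0 by rewrite MF_entry.
have z8 : MF F (inord 1) (Mcol 8) = 0 by rewrite MF_entry.
move: (single_col_bound z7 ob 2) (single_col_bound z8 ob 3).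
move: (single_col_bound z7 ob 4) (single_col_bound z7 ob 5).
rewrite !MF_entry //; cbn [nth M_rows].
have p2 : 0 <= w 2 b by apply: W_ge0.
have p3 : 0 <= w 3 b by apply: W_ge0.
have p4 : 0 <= w 4 b by apply: W_ge0.
rewrite /l1 /l2 w1; move: (w 0 b) (w 2 b) (w 3 b) (w 4 b) (w 5 b) x_gt0 p2 p3 p4.
move=> w0 w2 w3 w4 w5 x_gt0 p2 p3 p4 e1 e2 e3 e4; split; lra.
Qed.

(** Column 9 is tiny in row 4, and column 10 is tiny in row 5 and small in rows 2 and 3. *)
Lemma single_colA a : only_cols 1 0 = [set a] ->
  [/\ 0 < w 1 a, l1 a <= - 3 * w 1 a & - 1 / 2 * w 1 a <= l2 a <= 1 / 2 * w 1 a].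
Proof.
move=> oa.
have : a \in only_cols 1 0 by rewrite oa set11.
rewrite !inE => /andP[x_neq0 /eqP w0].
have x_gt0 : 0 < w 1 a by rewrite lt_neqAle eq_sym x_neq0 W_ge0.
have z9 : MF F (inord 0) (Mcol 9) = 0 by rewrite MF_entry.
have z10 : MF F (inord 0) (Mcol 10) = 0 by rewrite MF_entry.
move: (single_col_bound z10 oa 2) (single_col_bound z10 oa 3).
move: (single_col_bound z9 oa 4) (single_col_bound z10 oa 5).
rewrite !MF_entry //; cbn [nth M_rows].
have p2 : 0 <= w 2 a by apply: W_ge0.
have p3 : 0 <= w 3 a by apply: W_ge0.
have p5 : 0 <= w 5 a by apply: W_ge0.
rewrite /l1 /l2 w0; move: (w 1 a) (w 2 a) (w 3 a) (w 4 a) (w 5 a) x_gt0 p2 p3 p5.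
move=> w1 w2 w3 w4 w5 x_gt0 p2 p3 p5 e1 e2 e3 e4; split; [lra|lra|].
by apply/andP; split; lra.
Qed.

Lemma not_both_single a b : (d < 6)%N ->
  only_cols 0 1 = [set b] -> only_cols 1 0 = [set a] -> False.
Proof.
move=> d5 /single_colB [xb lb1 nb1 lb2] /single_colA [xa la1 /andP[la2 la2']].
(* Fewer than six columns leave a nonzero [y] with [y *m W = 0], hence also [y *m M = 0]. *)
have : kermx W != 0.
  rewrite kermx_eq0 /row_free neq_ltn (leq_ltn_trans (rank_leq_col W)) //.
case/rowV0Pn => y /sub_kermxP yW; apply/negP/negPn/eqP.
have yM j : y 0 (inord 0) * MF F (inord 0) j + y 0 (inord 1) * MF F (inord 1) j
    + y 0 (inord 2) * MF F (inord 2) j + y 0 (inord 3) * MF F (inord 3) j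
    + y 0 (inord 4) * MF F (inord 4) j + y 0 (inord 5) * MF F (inord 5) j = 0.
  have := congr1 (fun A : 'M_(_, _) => A 0 j) (congr1 (mulmx^~ H) yW).
  by rewrite -mulmxA -MWH mul0mx [RHS]mxE mxE sum_inord6.
have yWk k : y 0 (inord 0) * w 0 k + y 0 (inord 1) * w 1 k
    + y 0 (inord 2) * w 2 k + y 0 (inord 3) * w 3 k
    + y 0 (inord 4) * w 4 k + y 0 (inord 5) * w 5 k = 0.
  have := congr1 (fun A : 'M_(_, _) => A 0 k) yW.
  by rewrite [RHS]mxE mxE sum_inord6.
(* Columns 0 to 3 of M already force [y] into the row span of [left_kernel]. *)
have [e0 e1 e2 e3] : [/\ y 0 (inord 0) = - 4 / 5 * y 0 (inord 4) - 2 / 5 * y 0 (inord 5),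
    y 0 (inord 1) = - 9 / 2 * y 0 (inord 4),
    y 0 (inord 2) = - 4 * y 0 (inord 4) - 6 * y 0 (inord 5)
  & y 0 (inord 3) = 8 * y 0 (inord 4) + 4 * y 0 (inord 5)].
  move: (yM (Mcol 0)) (yM (Mcol 1)) (yM (Mcol 2)) (yM (Mcol 3)).
  rewrite !MF_entry //; cbn [nth M_rows].
  move: (y 0 (inord 0)) (y 0 (inord 1)) (y 0 (inord 2)) (y 0 (inord 3))
        (y 0 (inord 4)) (y 0 (inord 5)).
  clear; move=> y0 y1 y2 y3 y4 y5 *; split; lra.
have yl k : y 0 (inord 4) * l1 k + y 0 (inord 5) * l2 k = 0.
  by rewrite -[RHS](yWk k) e0 e1 e2 e3 /l1 /l2; field.
(* In units of [w 0 b * w 1 a], the first product is at most 81/200 and the second at least 1. Hence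
   the system for the last two coordinates of [y] is regular. *)
have D_lt0 : l1 b * l2 a - l2 b * l1 a < 0.
  have u1 : 0 <= (l2 a + 1 / 2 * w 1 a) * - l1 b by rewrite mulr_ge0 //; lra.
  have u2 : 0 <= (l1 b + 81 / 100 * w 0 b) * w 1 a by rewrite mulr_ge0 //; lra.
  have u3 : 0 <= (- 1 / 3 * w 0 b - l2 b) * - l1 a by rewrite mulr_ge0 //; lra.
  have u4 : 0 <= w 0 b * (- 3 * w 1 a - l1 a) by rewrite mulr_ge0 //; lra.
  have u5 : 0 < w 0 b * w 1 a by rewrite mulr_gt0.
  lra.
have y4 : y 0 (inord 4) = 0.
  have : y 0 (inord 4) * (l1 b * l2 a - l2 b * l1 a) = 0.
    transitivity ((y 0 (inord 4) * l1 b + y 0 (inord 5) * l2 b) * l2 a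
      - (y 0 (inord 4) * l1 a + y 0 (inord 5) * l2 a) * l2 b); first by ring.
    by rewrite !yl !mul0r subrr.
  by move/eqP; rewrite mulf_eq0 (lt_eqF D_lt0) orbF => /eqP.
have y5 : y 0 (inord 5) = 0.
  have : y 0 (inord 5) * (l1 b * l2 a - l2 b * l1 a) = 0.
    transitivity ((y 0 (inord 4) * l1 a + y 0 (inord 5) * l2 a) * l1 b
      - (y 0 (inord 4) * l1 b + y 0 (inord 5) * l2 b) * l1 a); first by ring.
    by rewrite !yl !mul0r subrr.
  by move/eqP; rewrite mulf_eq0 (lt_eqF D_lt0) orbF => /eqP.
have yi (i : nat) : (i < 6)%N -> y 0 (inord i) = 0.
  by case: i => [|[|[|[|[|[|//]]]]]] _ //; rewrite ?e0 ?e1 ?e2 ?e3 ?y4 ?y5; ring.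
by apply/rowP => i; rewrite -(inord_val i) yi // mxE.
Qed.

Lemma card_types : (d < 6)%N ->
  [/\ #|only_cols 0 1| = 2, #|only_cols 1 0| = 2, #|edge_cols| = 1 & d = 5]%N.
Proof.
move=> d5.
have cU := cardsUI (zero_cols 0) (zero_cols 1).
have cd : (#|zero_cols 0 :|: zero_cols 1| <= d)%N.
  by rewrite -[X in (_ <= X)%N]card_ord max_card.
have cB : #|zero_cols 1| = (#|edge_cols| + #|only_cols 0 1|)%N.
  by rewrite -(cardsID (zero_cols 0) (zero_cols 1)) setIC.
have cA : #|zero_cols 0| = (#|edge_cols| + #|only_cols 1 0|)%N.
  by rewrite -(cardsID (zero_cols 1) (zero_cols 0)).
rewrite -/edge_cols in cU.
have [supB kerB] := card_zero_cols (or_introl erefl) MF_zeroB.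
have [supA kerA] := card_zero_cols (or_intror erefl) MF_zeroA.
have B3 : (2 < #|zero_cols 1|)%N.
  by apply: supB => i j k kz; rewrite (unused_cols (MF_zeroB j) kz) mulr0.
have A3 : (2 < #|zero_cols 0|)%N.
  by apply: supA => i j k kz; rewrite (unused_cols (MF_zeroA j) kz) mulr0.
have B0 : (0 < #|only_cols 0 1|)%N.
  apply: (@only_cols_gt0 0 1 (Mcol 0)); rewrite MF_entry //; cbn [nth M_rows].
  by apply: lt0r_neq0; lra.
have A0 : (0 < #|only_cols 1 0|)%N.
  apply: (@only_cols_gt0 1 0 (Mcol 3)); rewrite MF_entry //; cbn [nth M_rows].
  by apply: lt0r_neq0; lra.
(* With exactly three such columns, [b] would lie in the column space and [l1 b] would be 0. *)
have B1 : #|only_cols 0 1| = 1%N -> #|zero_cols 1| <> 3%N.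
  move/eqP/cards1P => [b ob] /kerB /(_ b).
  have : b \in only_cols 0 1 by rewrite ob set11.
  rewrite in_setD => /andP[_ ->] /(_ isT) [e4 _].
  by have [_ _ + _] := single_colB ob; rewrite /l1 e4; lra.
have A1 : #|only_cols 1 0| = 1%N -> #|zero_cols 0| <> 3%N.
  move/eqP/cards1P => [a oa] /kerA /(_ a).
  have : a \in only_cols 1 0 by rewrite oa set11.
  rewrite in_setD => /andP[_ ->] /(_ isT) [e4 _].
  by have [x_gt0 + _] := single_colA oa; rewrite /l1 e4; lra.
have AB1 : ~ (#|only_cols 0 1| = 1 /\ #|only_cols 1 0| = 1)%N.
  by case=> /eqP/cards1P [b ob] /eqP/cards1P [a oa]; apply: not_both_single ob oa.
clear -d5 cU cd cA cB B3 A3 B0 A0 B1 A1 AB1; split; lia.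
Qed.

(** * The quadratic equation for the slope t *)

Lemma nmf5_quadratic : (d < 6)%N -> exists t : F, 2 * t ^+ 2 - 4 * t + 1 = 0.
Proof.
move=> d5; have [cB cA cC _] := card_types d5.
have [supB kerB] := card_zero_cols (or_introl erefl) MF_zeroB.
have [_ kerA] := card_zero_cols (or_intror erefl) MF_zeroA.
have zB3 : #|zero_cols 1| = 3.
  by rewrite -(cardsID (zero_cols 0) (zero_cols 1)) setIC -/edge_cols cC cB.
have zA3 : #|zero_cols 0| = 3.
  by rewrite -(cardsID (zero_cols 1) (zero_cols 0)) -/edge_cols cC cA.
have {kerB}kerB := kerB zB3; have {kerA}kerA := kerA zA3.
have /eqP/cards1P [c ec] := cC.
have /eqP/cards2P [b1 [b2 [b12 ob]]] := cB.
have /eqP/cards2P [a1 [a2 [a12 oa]]] := cA.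
have in_only r r' k : k \in only_cols r r' -> [/\ 0 < w r k, w r' k = 0 & k \in zero_cols r'].
  rewrite in_setD => /andP[]; rewrite !inE => wr /eqP -> ; split => //.
  by rewrite lt_neqAle eq_sym wr W_ge0.
have [xb1 zb1 /kerB [b1_4 b1_5]] : [/\ 0 < w 0 b1, w 1 b1 = 0 & b1 \in zero_cols 1].
  by apply: in_only; rewrite ob !inE eqxx.
have [xb2 zb2 /kerB [b2_4 b2_5]] : [/\ 0 < w 0 b2, w 1 b2 = 0 & b2 \in zero_cols 1].
  by apply: in_only; rewrite ob !inE eqxx orbT.
have [xa1 za1 /kerA [a1_4 a1_5]] : [/\ 0 < w 1 a1, w 0 a1 = 0 & a1 \in zero_cols 0].
  by apply: in_only; rewrite oa !inE eqxx.
have [xa2 za2 /kerA [a2_4 a2_5]] : [/\ 0 < w 1 a2, w 0 a2 = 0 & a2 \in zero_cols 0].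
  by apply: in_only; rewrite oa !inE eqxx orbT.
have [zc0 zc1 [c_4 c_5]] : [/\ w 0 c = 0, w 1 c = 0 &
    w 4 c = 4 / 5 * w 0 c + 9 / 2 * w 1 c + 4 * w 2 c - 8 * w 3 c
     /\ w 5 c = 2 / 5 * w 0 c + 6 * w 2 c - 4 * w 3 c].
  have : c \in edge_cols by rewrite ec set11.
  case/setIP => c0 c1; split; [by move: c0; rewrite inE => /eqP | | exact: kerB].
  by move: c1; rewrite inE => /eqP.
have w_ge0 i k : 0 <= w i k by apply: W_ge0.
have c3 := w_ge0 3 c; have c4 := w_ge0 4 c; have c2 := w_ge0 2 c.
(* Otherwise [0 <= w 4 c] makes c the zero column, and the two columns of [only_cols 0 1] alone
   would carry a group of rank 3. *)
have c2_gt0 : 0 < w 2 c.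
  rewrite lt_neqAle eq_sym c2 andbT; apply/eqP => c20.
  have wc0 i : W i c = 0.
    rewrite -(inord_val i) -/(w i c); case: i => [[|[|[|[|[|[|//]]]]]] hi] /=; lra.
  suff : (2 < #|only_cols 0 1|)%N by rewrite cB.
  apply: supB => i j k kB.
  have [kz|kz] := boolP (k \in zero_cols 1); last first.
    by rewrite (unused_cols (MF_zeroB j) kz) mulr0.
  suff -> : k = c by rewrite wc0 mul0r.
  apply/set1P; rewrite -ec /edge_cols in_setI kz andbT.
  by move: kB; rewrite in_setD kz andbT negbK.
pose t := w 3 c / w 2 c.
have tE : w 2 c * t = w 3 c by rewrite /t mulrC divfK // gt_eqF.
have t_ge0 : 0 <= t by rewrite divr_ge0.
(* This is [0 <= w 4 c], with [w 4 c = 4 * w 2 c - 8 * w 3 c]. *)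
have t_le : t <= 1 / 2 by rewrite ler_pdivrMr //; lra.
have coverB j : MF F (inord 1) j = 0 ->
    covers t (w 2 c) (w 0 b1) (w 2 b1) (w 3 b1) (w 0 b2) (w 2 b2) (w 3 b2)
      (MF F (inord 0) j) (MF F (inord 2) j) (MF F (inord 3) j).
  move=> z; have S := two_cols_sum z b12 ob ec.
  exists (H b1 j, H b2 j, H c j); split => /=; first by split; apply: H_ge0.
  - by rewrite S -/(w 0 b1) -/(w 0 b2) -/(w 0 c) zc0; ring.
  - by rewrite S -/(w 2 b1) -/(w 2 b2) -/(w 2 c); ring.
  - by rewrite S -/(w 3 b1) -/(w 3 b2) -/(w 3 c) tE; ring.
have ec' : zero_cols 1 :&: zero_cols 0 = [set c] by rewrite setIC.
have coverA j : MF F (inord 0) j = 0 ->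
    covers t (w 2 c) (w 1 a1) (w 2 a1) (w 3 a1) (w 1 a2) (w 2 a2) (w 3 a2)
      (MF F (inord 1) j) (MF F (inord 2) j) (MF F (inord 3) j).
  move=> z; have S := two_cols_sum z a12 oa ec'.
  exists (H a1 j, H a2 j, H c j); split => /=; first by split; apply: H_ge0.
  - by rewrite S -/(w 1 a1) -/(w 1 a2) -/(w 1 c) zc1; ring.
  - by rewrite S -/(w 2 a1) -/(w 2 a2) -/(w 2 c); ring.
  - by rewrite S -/(w 3 a1) -/(w 3 a2) -/(w 3 c) tE; ring.
exists t; apply/le_anti/andP; split.
  have zA j : (j < 3)%N -> MF F (inord 0) (Mcol (3 + j)) = 0.
    by move=> j3; have := MF_zeroA (Ordinal j3).
  have := coverA _ (zA 0%N isT); have := coverA _ (zA 1%N isT).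
  have := coverA _ (zA 2%N isT); rewrite !MF_entry // => C5 C4 C3.
  apply: (@facetA _ t (w 2 c) _ _ _ _ _ _ t_ge0 t_le c2 xa1 xa2 _ _ _ _ C3 C4 C5).
  - by have := w_ge0 4 a1; lra.
  - by have := w_ge0 4 a2; lra.
  - by have := w_ge0 5 a1; lra.
  - by have := w_ge0 5 a2; lra.
have zB j : (j < 3)%N -> MF F (inord 1) (Mcol j) = 0.
  by move=> j3; have := MF_zeroB (Ordinal j3).
have := coverB _ (zB 0%N isT); have := coverB _ (zB 1%N isT).
have := coverB _ (zB 2%N isT); rewrite !MF_entry // => C2 C1 C0.
by apply: (@facetB _ t (w 2 c) _ _ _ _ _ _ t_ge0 t_le c2 xb1 xb2 _ _ _ _ C0 C1 C2).
Qed.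

End NMF.

(** * Irrationality and the two ranks *)

Lemma rat_sqr_neq2 (x : rat) : x ^+ 2 <> 2.
Proof.
move=> x2.
have d_neq0 : (denq x)%:~R != 0 :> rat by rewrite intr_eq0 denq_neq0.
have eqz : numq x ^+ 2 = 2 * denq x ^+ 2.
  apply: (@intr_inj rat); rewrite !expr2 !intrM -[2%:~R]x2 -!expr2 -exprMn.
  by rewrite -[X in (X * _) ^+ 2]divq_num_den divfK.
have : (`|numq x| ^ 2 = 2 * `|denq x| ^ 2)%N.
  by have := congr1 absz eqz; rewrite abszM !abszX.
(* The exponent of 2 is even on the left and odd on the right. *)
move/(congr1 (logn 2)); rewrite lognM ?expn_gt0 ?absz_gt0 ?denq_neq0 // !lognX.
rewrite (logn_prime 2 (isT : prime 2)) /=; lia.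
Qed.

Lemma nmf_ge5 (F : realFieldType) e : has_nmf (MF F) e -> (5 <= e)%N.
Proof.
move=> [W [H [W_ge0 H_ge0 E]]]; rewrite leqNgt; apply/negP => e5.
by have [_ _ _ e5'] := card_types W_ge0 H_ge0 E (ltnW e5); rewrite e5' in e5.
Qed.

Theorem theorem3p1 :
  (forall R : realType, is_nonneg_rank (map_mx (ratr : rat -> R) Mmat) 5)
  /\ is_nonneg_rank Mmat 6.
Proof.
split=> [R|].
  split; last exact: nmf_ge5.
  have s_ge0 : 0 <= Num.sqrt 2 :> R by exact: sqrtr_ge0.
  have ss : Num.sqrt 2 * Num.sqrt 2 = 2 :> R by rewrite -expr2 sqr_sqrtr.
  exists (sqrt2_W (Num.sqrt 2)), (sqrt2_H (Num.sqrt 2)).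
  by split; [exact: sqrt2_W_ge0 | exact: sqrt2_H_ge0 | exact: sqrt2_WH].
split.
  exists 1%:M, Mmat; split; [|exact: Mmat_nonneg|by rewrite mul1mx].
  by move=> i j; rewrite mxE ler0n.
move=> e [W [H [W_ge0 H_ge0 E]]]; rewrite leqNgt; apply/negP => e6.
have MF_rat : MF rat = Mmat.
  by apply/matrixP => i j; rewrite /MF map_Mmat_rows Mmat_rows.
rewrite -MF_rat in E.
have [t t0] := nmf5_quadratic W_ge0 H_ge0 E e6.
(* Completing the square turns the quadratic into [(2 * (t - 1)) ^+ 2 = 2]. *)
apply: (@rat_sqr_neq2 (2 * (t - 1))).
transitivity (2 * (2 * t ^+ 2 - 4 * t + 1) + 2); first by ring.
by rewrite t0 mulr0 add0r.
Qed.
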